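(* The following assertions hold, where $\operatorname{val}(P_{c,b})$ and $\operatorname{val}(P^*_{c,b})$ denote the optimal values of the primal and dual conic linear programs and $h_c$ is the value function (see context). (i) For all $c\in X^*$ and $b\in Y$: $h_c(b)=\operatorname{val}(P_{c,b})$; $h_c^{**}(b)=\operatorname{val}(P^*_{c,b})$; $\operatorname{val}(P_{c,b})\ge \operatorname{val}(P^*_{c,b})$; $\operatorname{val}(P_{c,b})<\infty \Leftrightarrow b\in A(P)-Q$; $\operatorname{val}(P^*_{c,b})>-\infty\Leftrightarrow c\in P^{+}+A^*(Q^{+})$. Consequently, $g(c,b)\in[0,\infty[$ for all $(c,b)\in\Lambda$. (ii) For $c\in X^*$, $b\in Y$: [$h_c(b)\in\mathbb{R}$ and $h_c$ is lower semicontinuous at $b$] $\Leftrightarrow$ $\operatorname{val}(P_{c,b})=\operatorname{val}(P^*_{c,b})\in\mathbb{R}$. (iii) For $c\in X^*$, $b\in Y$: $\partial h_c(b)\ne\emptyset$ $\Leftrightarrow$ [$\operatorname{val}(P_{c,b})=\operatorname{val}(P^*_{c,b})\in\mathbb{R}$ and $(P^*_{c,b})$ has optimal solutions]; moreover, $\operatorname{Sol}(P^*_{c,b})=\partial h_c(b)$ if $\partial h_c(b)\neq\emptyset$, where $\operatorname{Sol}(P^*_{c,b})$ is the set of optimal solutions of $(P^*_{c,b})$. (iv) For $c\in X^*$: $\overline{h_c}$ is proper $\Leftrightarrow$ $h_c^*$ is proper $\Leftrightarrow$ $\operatorname{dom}h_c^*\ne\emptyset$ $\Leftrightarrow$ $c\in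 P^{+}+A^*(Q^{+})$.
   Context: $X,Y$ are real Hausdorff locally convex spaces with topological duals $X^*,Y^*$ endowed with their weak-star topologies; $\langle x,x^*\rangle:=x^*(x)$. The dual of $(Y^*,w^* )$ is identified with $Y$. $A:X\to Y$ is a continuous linear operator with adjoint $A^*:Y^*\to X^*$, $A^*y^*=y^*\circ A$. $P\subset X$, $Q\subset Y$ are convex cones (nonempty sets closed under addition and under multiplication by scalars $t\in[0,\infty[$; not assumed closed), and $P^+:=\{x^*\in X^*\mid \langle x,x^*\rangle\ge 0\ \forall x\in P\}$, $Q^+:=\{y^*\in Y^*\mid\langle y,y^*\rangle\ge0\ \forall y\in Q\}$. For $c\in X^*$, $b\in Y$: $(P_{c,b})$: minimize $\langle x,c\rangle$ subject to $x\in P$, $Ax-b\in Q$; $(P^*_{c,b})$: maximize $\langle b,y^*\rangle$ subject to $y^*\in Q^+$, $A^*y^*-c\in -P^+$. Their values in $\overline{\mathbb{R}}=\mathbb{R}\cup\{-\infty,\infty\}$ are $\operatorname{val}(P_{c,b})$ and $\operatorname{val}(P^*_{c,b})$, with $\inf\emptyset=\infty$, $\sup\emptyset=-\infty$. The value function is $h_c:Y\to\overline{\mathbb{R}}$, $h_c(y):=\inf\{\langle x,c\rangle\mid x\in P,\ Ax-y\in Q\}$. $\Lambda:=\{(c,b)\in X^*\times Y\mid (P_{c,b}) \text{ and } (P^*_{c,b})\text{ both have feasible points}\}=(P^{+}+A^{*}(Q^{+}))\times(A(P)-Q)$, and the duality gap function is $g(c,b):=\operatorname{val}(P_{c,b})-\operatorname{val}(P^*_{c,b})$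 for $(c,b)\in\Lambda$. For $f:Y\to\overline{\mathbb{R}}$: $\operatorname{dom}f=\{y\mid f(y)<\infty\}$; $f$ is proper if $\operatorname{dom} f\ne\emptyset$ and $f$ never takes the value $-\infty$; $\overline f$ is the lower semicontinuous envelope, i.e. $\operatorname{epi}\overline f=\operatorname{cl}(\operatorname{epi}f)$ where $\operatorname{epi} f=\{(y,t)\in Y\times\mathbb{R}\mid f(y)\le t\}$; $f^*(y^* ):=\sup_{y\in Y}(\langle y,y^*\rangle-f(y))$ for $y^*\in Y^*$; $f^{**}(y):=\sup_{y^*\in Y^*}(\langle y,y^*\rangle-f^*(y^* ))$ for $y\in Y$ (same definitions of dom and proper for functions on $Y^*$); $\partial f(y):=\{y^*\in Y^*\mid \langle y'-y,y^*\rangle\le f(y')-f(y)\ \forall y'\in Y\}$ if $f(y)\in\mathbb{R}$ and $\partial f(y):=\emptyset$ otherwise; $f$ is lower semicontinuous at $y$ if $\liminf_{y'\to y}f(y')\ge f(y)$. *)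

(* Defs.v *)
From HB Require Import structures.
From mathcomp Require Import all_boot all_order all_algebra.
From mathcomp Require Import lra.
From mathcomp Require Import all_classical all_reals all_analysis.

Set Implicit Arguments.
Unset Strict Implicit.
Unset Printing Implicit Defensive.

Import Order.TTheory GRing.Theory Num.Theory.
Import numFieldNormedType.Exports.

Local Open Scope classical_set_scope.
Local Open Scope ring_scope.

Section continuous_linear.
Context {R : realType}.

Definition clin_pred (X Y : tvsType R) : {pred X -> Y} :=
  mem [set f : X -> Y | linear f /\ continuous f].
Arguments clin_pred : clear implicits.

Record clin (X Y : tvsType R) := Clin {
  clin_fun :> X -> Y ;
  clinP : clin_fun \in clin_pred X Y }.

Section clin_lmod.
Context {X Y : tvsType R}.

HB.instance Definition _ := [isSub of clin X Y for @clin_fun X Y].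
HB.instance Definition _ := [Choice of clin X Y by <:].

Lemma clin_submod_closed : submod_closed (clin_pred X Y).
Proof.
split=> [|a f g].
  rewrite inE; split=> [k x y|]; last exact: cst_continuous.
  by rewrite /= scaler0 addr0.
rewrite !inE => -[fl fc] [gl gc]; split=> [k x y|x].
  by rewrite !fctE fl gl !scalerDr !scalerA addrACA [a * k]mulrC.
have afc : {for x, continuous (fun x => a *: f x)}.
  apply: (@continuous_comp _ _ _ (fun x => (a : R^o, f x))
    (fun z : R^o * Y => z.1 *: z.2)); last exact: scale_continuous.
  by apply: (@cvg_pair _ _ _ _ (nbhs (a : R^o)) (nbhs (f x)));
    [exact: cvg_cst|exact: fc].
apply: (@continuous_comp _ _ _ (fun x => (a *: f x, g x))
  (fun z : Y * Y => z.1 + z.2)); last exact: add_continuous.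
by apply: (@cvg_pair _ _ _ _ (nbhs (a *: f x)) (nbhs (g x)));
  [exact: afc|exact: gc].
Qed.

HB.instance Definition _ :=
  GRing.isSubmodClosed.Build R (X -> Y) (clin_pred X Y) clin_submod_closed.
HB.instance Definition _ := [SubChoice_isSubLmodule of clin X Y by <:].

Lemma clin_linear (f : clin X Y) : linear f.
Proof. by have := clinP f; rewrite inE => -[]. Qed.

Lemma clin_continuous (f : clin X Y) : continuous f.
Proof. by have := clinP f; rewrite inE => -[]. Qed.

HB.instance Definition _ (f : clin X Y) :=
  GRing.isLinear.Build R X Y *:%R f (clin_linear f).

Lemma clinDE (f g : clin X Y) x : (f + g) x = f x + g x.
Proof. by []. Qed.

Lemma clinNE (f : clin X Y) x : (- f) x = - f x.
Proof. by []. Qed.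

Lemma clinZE a (f : clin X Y) x : (a *: f) x = a *: f x.
Proof. by []. Qed.

Lemma clin_ext (f g : clin X Y) : f =1 g -> f = g.
Proof. by move=> fg; apply: val_inj; apply/funext. Qed.

End clin_lmod.

Lemma clin_comp_subproof (X Y Z : tvsType R) (g : clin Y Z) (f : clin X Y) :
  g \o f \in clin_pred X Z.
Proof.
rewrite inE; split=> [k x y|x] /=; first by rewrite !linearP.
by apply: continuous_comp; exact: clin_continuous.
Qed.

Definition clin_comp (X Y Z : tvsType R) (g : clin Y Z) (f : clin X Y) :
  clin X Z := Clin (clin_comp_subproof g f).

End continuous_linear.

(* The weak-star topology is not needed: [biconj_fun] takes points of [Y] as the
   weak-star continuous linear functionals on [dual Y]. *)
Notation dual X := (clin X (GRing.regular _)).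

Section extended_real_functions.
Context {R : realType}.
Local Open Scope ereal_scope.

Definition edom (T : Type) (f : T -> \bar R) : set T := [set y | f y < +oo].

Definition proper_fun (T : Type) (f : T -> \bar R) : Prop :=
  edom f !=set0 /\ forall y, f y != -oo.

Definition epi (T : Type) (f : T -> \bar R) : set (T * R) :=
  [set yt | f yt.1 <= yt.2%:E].

(* The unique function whose epigraph is [closure (epi f)]: see [epi_lsc_env]
   and [epi_inj]. *)
Definition lsc_env (Y : topologicalType) (f : Y -> \bar R) (y : Y) : \bar R :=
  ereal_inf [set t%:E | t in [set t | closure (epi f) (y, t)]].

Lemma epi_lsc_env (Y : topologicalType) (f : Y -> \bar R) :
  epi (lsc_env f) = closure (epi f).
Proof.
apply/seteqP; split=> -[y t]; last first.
  by move=> yt; apply: ereal_inf_lbound; exists t.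
rewrite /epi/= => fyt B [[U V] /= [yU]].
rewrite -nbhs_ballE => -[_/posnumP[e] eV] UVB.
have : lsc_env f y < (t + e%:num / 2)%:E.
  by rewrite (le_lt_trans fyt)// lte_fin ltrDl.
move=> /ereal_inf_lt[_ [s /= cs <-]]; rewrite lte_fin => ste.
have /cs : nbhs (y, s) (U `*` ball s (e%:num / 2)).
  by exists (U, ball s (e%:num / 2)) => //; split => //=; exact: nbhsx_ballx.
move=> [[y' s'] [/= fys' [/= Uy']]].
rewrite /ball/= ltr_norml => /andP[s'1 s'2].
exists (y', Num.max s' t); split.
  by rewrite /epi/= (le_trans fys')// lee_fin le_max lexx.
apply: UVB; split => //=; apply: eV; rewrite /ball/= distrC ger0_norm.
  rewrite ltrBlDr gt_max ltrDr gt0 andbT.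
  by have := splitr e%:num; move: ste s'1 s'2; lra.
by rewrite subr_ge0 le_max lexx orbT.
Qed.

Lemma epi_inj (T : Type) : injective (@epi T).
Proof.
have le_of_epi (f g : T -> \bar R) y : epi f = epi g -> g y <= f y.
  move=> fg; have fgt t : f y <= t%:E -> g y <= t%:E.
    by move=> fyt; have : epi f (y, t) by []; rewrite fg.
  case: (f y) fgt => [r /(_ r)/(_ (lexx _))//|_|fgt]; first by rewrite leey.
  have {}fgt t : g y <= t%:E by apply: fgt; rewrite leNye.
  case: (g y) fgt => [r /(_ (r - 1)%R)|/(_ 0%R)|]//.
  by rewrite lee_fin lerDl oppr_ge0 ler10.
by move=> f g fg; apply/funext => y; apply/eqP; rewrite eq_le !le_of_epi.
Qed.

(* In both conjugates one of the summands is real, so no [+oo - +oo] occurs. *)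
Definition conj_fun (Y : tvsType R) (f : Y -> \bar R) (ys : dual Y) : \bar R :=
  ereal_sup [set (ys y)%:E - f y | y in [set: Y]].

Definition biconj_fun (Y : tvsType R) (f : Y -> \bar R) (y : Y) : \bar R :=
  ereal_sup [set (ys y)%:E - conj_fun f ys | ys in [set: dual Y]].

Definition subdiff (Y : tvsType R) (f : Y -> \bar R) (y : Y) : set (dual Y) :=
  [set ys | f y \is a fin_num /\
    forall y', (ys (y' - y)%R)%:E <= f y' - f y].

(* [nbhs y] contains [y] itself, which does not affect the inequality. *)
Definition lsc_at (Y : topologicalType) (f : Y -> \bar R) (y : Y) : Prop :=
  f y <= limf_einf f (nbhs y).

End extended_real_functions.

Section conic_programs.
Context {R : realType} {X Y : tvsType R}.

Definition convex_cone (V : lmodType R) (P : set V) : Prop :=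
  [/\ P !=set0, forall x y, P x -> P y -> P (x + y)
    & forall (t : R) x, 0 <= t -> P x -> P (t *: x)].

Definition dual_cone (V : tvsType R) (P : set V) : set (dual V) :=
  [set xs | forall x, P x -> 0 <= xs x].

Definition adjoint (A : clin X Y) : dual Y -> dual X :=
  fun ys => clin_comp ys A.

Context (P : set X) (Q : set Y) (A : clin X Y).

Definition primal_feasible (b : Y) : set X :=
  [set x | P x /\ Q (A x - b)].

Definition primal_val (c : dual X) (b : Y) : \bar R :=
  ereal_inf [set (c x)%:E | x in primal_feasible b].

Definition dual_feasible (c : dual X) : set (dual Y) :=
  [set ys | dual_cone Q ys /\ (-%R @` dual_cone P) (adjoint A ys - c)].

Definition dual_val (c : dual X) (b : Y) : \bar R :=
  ereal_sup [set (ys b)%:E | ys in dual_feasible c].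

Definition dual_sol (c : dual X) (b : Y) : set (dual Y) :=
  [set ys | dual_feasible c ys /\ (ys b)%:E = dual_val c b].

Definition value_fun (c : dual X) (y : Y) : \bar R :=
  ereal_inf [set (c x)%:E | x in [set x | P x /\ Q (A x - y)]].

Definition primal_dom : set Y := [set y - q | y in A @` P & q in Q].

Definition dual_dom : set (dual X) :=
  [set ps + xs | ps in dual_cone P & xs in adjoint A @` dual_cone Q].

Definition Lambda : set (dual X * Y) :=
  [set cb | primal_feasible cb.2 !=set0 /\ dual_feasible cb.1 !=set0].

Lemma LambdaE : Lambda = dual_dom `*` primal_dom.
Proof.
apply/seteqP; split=> -[c b]/=.
  move=> [[x [Px Qx]] [ys [Qys [ps Pps ysc]]]]; split.
    exists ps => //; exists (adjoint A ys); first by exists ys.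
    by rewrite -[ps]opprK ysc opprB subrK.
  exists (A x); first by exists x.
  by exists (A x - b) => //; rewrite opprB addrC subrK.
move=> [[ps Pps [_ [ys Qys <-] <-]] [_ [x Px <-] [q Qq <-]]]; split.
  by exists x; split => //; rewrite opprB addrC subrK.
by exists ys; split => //; exists ps => //; rewrite opprD addrCA subrr addr0.
Qed.

(* Only meaningful on [Lambda]: elsewhere [+oo - +oo] is [-oo] in [\bar R]. *)
Definition gap (c : dual X) (b : Y) : \bar R :=
  (primal_val c b - dual_val c b)%E.

End conic_programs.

(* Main.v *)
Require Import Defs.
From HB Require Import structures.
From mathcomp Require Import all_boot all_order all_algebra.
From mathcomp Require Import lra.
From mathcomp Require Import all_classical all_reals all_analysis.

Set Implicit Arguments.
Unset Strict Implicit.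
Unset Printing Implicit Defensive.

Import Order.TTheory GRing.Theory Num.Theory.
Import numFieldNormedType.Exports.

Local Open Scope classical_set_scope.
Local Open Scope ring_scope.

(** The value function [h c] is sublinear, and everything rests on two facts
about it.

First, the feasible points of the dual program are exactly the continuous
linear functionals below [h c] ([feasible_minorant]). By homogeneity, an
affine functional below [h c] can be replaced by its linear part
([affine_minorant_feasible]). Hence the conjugate of [h c] vanishes at the dual
feasible points and is infinite elsewhere, the biconjugate is the dual value,
and the subgradients of [h c] at [b] are the dual feasible points that attain
[h c b] at [b]. This settles weak duality, the domains and the subdifferential
with elementary computations.

Second, for [b] in the domain of [h c], each real [r] such that [(b, r)] is not
in the closed epigraph of [h c] is exceeded at [b] by some dual feasible point
([approximate_dual_solution]). At a point [b] where [h c] is finite and lower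
semicontinuous, every [r < h c b] is of this kind, so there is no duality gap.
If the lower semicontinuous envelope is proper, then [b = 0], [r = -1] is of
this kind, since otherwise the closed epigraph would contain the whole ray
generated by [(0, -1)]; so the dual program is feasible.

The second fact is the separation of a point from a convex cone in a locally
convex space ([cone_separation]), applied in [Y * R] to the cone of pairs
[(y, t)] for which some [x] in [P] satisfies [A x - y] in [Q] and [c x <= t].
The separation theorem is proved directly. A convex cone which is maximal among
those that avoid a convex neighbourhood of the point [z] is a half-space: it
contains [x] or [- x] for every [x]. The functional is read off from it as
[f x = sup {t | x + t z in the cone}]. *)

(** * Neighbourhoods in locally convex spaces *)

Section nbhs0.
Context {R : realType} {E : tvsType R}.

Lemma nbhs_convex (z : E) (S : set E) : nbhs z S ->
  exists U : set E, [/\ nbhs (0 : E) U,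
    forall (s t : R) u v, 0 <= s -> 0 <= t -> s + t = 1 -> U u -> U v ->
      U (s *: u + t *: v)
    & forall u, U u -> S (z + u)].
Proof.
move=> zS; have [B Bconvex [Bopen Bbasis]] := @locally_convex R E.
have [V [BV Vz] VS] := Bbasis z S zS.
exists [set u | V (z + u)]; split => [|s t u v s0 t0 st' Vu Vv|u /VS//].
  have : nbhs z V by apply: open_nbhs_nbhs; split=> //; exact: Bopen.
  move=> /(nbhsB (- z)); rewrite addNr; apply: filterS => _ [w Vw <-] /=.
  by rewrite addrA subrr add0r.
have s1 : s <= 1 by rewrite -st' lerDl.
have cV : convex_set V by apply: Bconvex; rewrite inE.
have := cV (z + u) (z + v) (Itv01 s0 s1).
rewrite !inE => /(_ Vu Vv); congr (V _).
have st : 1 - s = t by rewrite -st' addrAC subrr add0r.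
rewrite /conv/= /unstable.onem st.
by rewrite !scalerDr addrACA -scalerDl st' scale1r.
Qed.

Lemma nbhs0_absorbing (U : set E) (x : E) : nbhs (0 : E) U ->
  exists2 e : R, 0 < e & U (e *: x).
Proof.
move=> U0; have /= := @scale_continuous R E (0, x) U.
rewrite scale0r => /(_ U0) [[B C] [/= B0 C0] BC].
move: B0; rewrite -nbhs_ballE => -[e /= e0 eB].
exists (e / 2); first by rewrite divr_gt0.
apply: (BC (e / 2, x)); split=> /=; last exact: nbhs_singleton.
apply: eB; rewrite /ball/= sub0r normrN gtr0_norm ?divr_gt0//.
by rewrite ltr_pdivrMr// ltr_pMr//; lra.
Qed.

Lemma additive_continuous (f : E -> R^o) : {morph f : x y / x + y} ->
  (forall e : R, 0 < e -> \forall x \near (0 : E), `|f x| <= e) -> continuous f.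
Proof.
move=> fD f0 x; apply/cvgrPdist_le => e /f0 He.
have := nbhsB x He; rewrite addr0; apply: filterS => _ [w /= fw <-].
by rewrite fD opprD addrA subrr sub0r normrN.
Qed.

End nbhs0.

(** * Separation of a point from a convex cone *)

Section cone_separation.
Context {R : realType} {E : tvsType R}.
Implicit Types (K : set E) (x y z : E).

Lemma convex_cone0 K : convex_cone K -> K 0.
Proof. by move=> [[x Kx] _ /(_ 0 x (lexx _) Kx)]; rewrite scale0r. Qed.

Definition avoiding_cone K (S : set E) (C : set E) : Prop :=
  [/\ convex_cone C, K `<=` C & C `&` S = set0].

Lemma maximal_avoiding_cone K (S : set E) :
  convex_cone K -> K `&` S = set0 ->
  exists2 C, avoiding_cone K S C &
    forall D, avoiding_cone C S D -> D `<=` C.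
Proof.
move=> cK KS; have [_ KD KZ] := cK.
(* Joining [K] to each set makes the union of the empty chain admissible. *)
have [F FS totF|C [CK maxC]] :=
  @Zorn_bigcup E [set C | avoiding_cone K S (C `|` K)]; last first.
  exists (C `|` K) => // D [cD CKD DS] x Dx; left; apply: contrapT => Cx.
  have CD : C `<=` D by move=> y Cy; apply: CKD; left.
  have KD' : K `<=` D by move=> y Ky; apply: CKD; right.
  apply: (maxC D); first by split=> // /(_ x Dx).
  by rewrite /= (setUidl KD').
set U := \bigcup_(X in F) X.
have Ucase x : (U `|` K) x -> K x \/ exists2 X, F X & X x.
  by case=> [[X FX Xx]|]; [right; exists X|left].
have UF X x : F X -> (X `|` K) x -> (U `|` K) x.
  by move=> FX [Xx|]; [left; exists X|right].
have UD X x y : F X -> (X `|` K) x -> (X `|` K) y -> (U `|` K) (x + y).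
  by move=> FX Xx Xy; apply: (UF X) => //; have [[_ /(_ _ _ Xx Xy)]] := FS X FX.
split; [split| by move=> x; right |].
- by exists 0; right; exact: convex_cone0.
- move=> x y /Ucase[Kx|[X FX Xx]] /Ucase[Ky|[Z FZ Zy]].
  + by right; exact: KD.
  + by apply: (UD Z) => //; [right|left].
  + by apply: (UD X) => //; [left|right].
  + have [XZ|ZX] := totF X Z FX FZ.
      by apply: (UD Z) => //; left => //; exact: XZ.
    by apply: (UD X) => //; left => //; exact: ZX.
- move=> t x t0 /Ucase[Kx|[X FX Xx]]; first by right; exact: KZ.
  by apply: (UF X) => //; have [[_ _ XZ] _ _] := FS X FX; apply: XZ => //; left.
- apply/seteqP; split=> // x [/Ucase[Kx|[X FX Xx]] Sx]; first by rewrite -KS.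
  by have [_ _ <-] := FS X FX; split=> //; left.
Qed.

(** If [C] contained neither [x] nor [- x], the cones generated by [C] with [x]
and by [C] with [- x] would both meet the convex set [S]. In a suitable convex
combination of the two common points the multiples of [x] cancel, which gives
a point of [C] in [S]. *)
Lemma maximal_avoiding_cone_total (z : E) (U C : set E) (S := +%R z @` U) :
  (forall (s t : R) u v, 0 <= s -> 0 <= t -> s + t = 1 -> U u -> U v ->
      U (s *: u + t *: v)) ->
  avoiding_cone C S C ->
  (forall D, avoiding_cone C S D -> D `<=` C) ->
  forall x, C x \/ C (- x).
Proof.
move=> cU [cC _ CS] maxC x; apply: contrapT => /not_orP[Cx CNx].
have [_ CD CZ] := cC; have C0 := convex_cone0 cC.
have meets y : ~ C y -> exists k t u, [/\ C k, 0 < t, U u & k + t *: y = z + u].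
  move=> Cy; apply: contrapT => nomeet; apply: Cy.
  pose D := [set w | exists k t, [/\ C k, 0 <= t & w = k + t *: y]].
  suff : D `<=` C by apply; exists 0, 1; rewrite scale1r add0r.
  apply: maxC; split; [split| |].
  - by exists 0; exists 0, 0; rewrite scale0r addr0.
  - move=> _ _ [k [t [Ck t0 ->]]] [l [s [Cl s0 ->]]].
    by exists (k + l), (t + s); split;
      [exact: CD|exact: addr_ge0|rewrite scalerDl addrACA].
  - move=> r _ r0 [k [t [Ck t0 ->]]]; exists (r *: k), (r * t).
    by split; [exact: CZ|exact: mulr_ge0|rewrite scalerDr scalerA].
  - by move=> w Cw; exists w, 0; rewrite scale0r addr0.
  - apply/seteqP; split=> // _ [[k [t [Ck t0 ->]]] [u Uu zu]].
    move: t0; rewrite le_eqVlt => /predU1P[t0|t0].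
      by rewrite -CS; split; [rewrite -t0 scale0r addr0|exists u].
    by apply: nomeet; exists k, t, u.
have [k [t [u [Ck t0 Uu kt]]]] := meets _ Cx.
have [l [s [v [Cl s0 Uv ls]]]] := meets _ CNx.
have st0 : 0 < s + t by rewrite addr_gt0.
have st1 : s / (s + t) + t / (s + t) = 1 by rewrite -mulrDl divff// gt_eqF.
(* The weights [s / (s + t)] and [t / (s + t)] cancel [t *: x] against
   [s *: - x]. *)
suff : (C `&` S) ((s / (s + t)) *: (k + t *: x) + (t / (s + t)) *: (l + s *: - x)).
  by rewrite CS.
have s'0 : 0 <= s / (s + t) by rewrite divr_ge0// ltW.
have t'0 : 0 <= t / (s + t) by rewrite divr_ge0// ltW.
split; last first.
  rewrite kt ls; exists ((s / (s + t)) *: u + (t / (s + t)) *: v).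
    exact: cU.
  by rewrite !scalerDr addrACA -[in RHS]scalerDl st1 scale1r.
rewrite !scalerDr addrACA !scalerN !scalerA.
rewrite [_ * t]mulrAC [t / _ * s]mulrAC [t * s]mulrC subrr addr0.
by apply: CD; exact: CZ.
Qed.

(** The functional [f x = sup {t | x + t z in C}] is superadditive and
positively homogeneous because [C] is a convex cone; it is odd, hence linear,
because [C] contains one of every two opposite points. On [z] it takes a value at
most [-1]. It is finite because [U] is absorbing, and continuous because it is
at most [1] on [U]. *)
Lemma half_space_functional (z : E) (U C : set E) :
  nbhs (0 : E) U -> convex_cone C -> (forall x, C x \/ C (- x)) ->
  (forall u, U u -> ~ C (z + u)) ->
  exists f : dual E, (forall x, C x -> 0 <= f x) /\ f z < 0.
Proof.
move=> U0 cC totC CU; have [_ CD CZ] := cC; have C0 := convex_cone0 cC.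
have CNzu u : U u -> C (- z - u).
  by move=> Uu; rewrite -opprD; have [/(CU _ Uu)|] := totC (z + u).
have CNz : C (- z) by have := CNzu 0 (nbhs_singleton U0); rewrite subr0.
pose A x := [set t : R | C (x + t *: z)].
have Adown x s t : s <= t -> A x t -> A x s.
  move=> st Axt; rewrite /A/=.
  have -> : x + s *: z = x + t *: z + (t - s) *: - z.
    by rewrite scalerN -scaleNr opprB scalerBl addrACA subrr addr0.
  by apply: CD => //; apply: CZ => //; rewrite subr_ge0.
have A0 x : A x !=set0.
  have [e e0 /CNzu] := nbhs0_absorbing (- x) U0.
  rewrite scalerN opprK => Czx; exists (- e^-1); rewrite /A/=.
  have := CZ e^-1 _ _ Czx; rewrite invr_ge0 (ltW e0) => /(_ isT).
  by rewrite scalerDr scalerA mulVf ?gt_eqF// scale1r scalerN scaleNr addrC.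
have Aub x : has_ubound (A x).
  have [e e0 /CU zx] := nbhs0_absorbing x U0; exists e^-1 => t Axt.
  rewrite leNgt; apply/negP => /ltW et; apply: zx.
  have := CZ e _ (ltW e0) (Adown _ _ _ et Axt).
  by rewrite scalerDr scalerA divff ?gt_eqF// scale1r addrC.
pose f x : R^o := sup (A x).
have f_ge x t : A x t -> t <= f x by move=> Axt; exact: ub_le_sup.
have f_le x t : (forall s, A x s -> s <= t) -> f x <= t.
  by move=> xt; apply: ge_sup => //; exact: A0.
have f_super x y : f x + f y <= f (x + y).
  rewrite -lerBrDr; apply: (f_le) => s Axs; rewrite lerBrDr -lerBrDl.
  apply: f_le => t Ayt; rewrite lerBrDl; apply: f_ge; rewrite /A/=.
  by rewrite scalerDl addrACA; exact: CD.
have f0 : f 0 = 0.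
  apply/eqP; rewrite eq_le; apply/andP; split; last first.
    by apply: f_ge; rewrite /A/= scale0r addr0.
  apply: f_le => t; rewrite /A/= add0r => Ctz; rewrite leNgt; apply/negP => t0.
  apply: (CU 0); first exact: nbhs_singleton.
  have := CZ t^-1 _ _ Ctz; rewrite invr_ge0 (ltW t0) => /(_ isT).
  by rewrite scalerA mulVf ?gt_eqF// scale1r addr0.
have fN x : f (- x) = - f x.
  apply/eqP; rewrite eq_le; apply/andP; split.
    by rewrite -subr_ge0 -opprD oppr_ge0; have := f_super x (- x); rewrite subrr f0.
  rewrite lerNl; apply/ler_addgt0Pr => e e0; rewrite lerNl.
  apply: (f_ge); rewrite /A/= scaleNr -opprD.
  have [/f_ge|//] := totC (x + (f x + e) *: z).
  by rewrite gerDl leNgt e0.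
have fD x y : f (x + y) = f x + f y.
  apply/eqP; rewrite eq_le f_super andbT -lerN2 opprD -!fN opprD.
  exact: f_super.
have fZ_ge (t : R) x : 0 < t -> t * f x <= f (t *: x).
  move=> t0; rewrite -ler_pdivlMl//; apply: f_le => s Axs.
  rewrite ler_pdivlMl//; apply: f_ge; rewrite /A/= -scalerA -scalerDr.
  by apply: CZ => //; exact: ltW.
have fZ_pos (t : R) x : 0 < t -> f (t *: x) = t * f x.
  move=> t0; apply/eqP; rewrite eq_le fZ_ge// andbT -ler_pdivrMl//.
  have := fZ_ge t^-1 (t *: x).
  by rewrite scalerA mulVf ?gt_eqF// scale1r invr_gt0; exact.
have fZ t x : f (t *: x) = t * f x.
  have [t0|t0|->] := ltgtP t 0; last by rewrite scale0r mul0r.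
    by rewrite -[t in LHS]opprK scaleNr fN fZ_pos ?oppr_gt0// mulNr opprK.
  exact: fZ_pos.
have fU u : U u -> f u <= 1.
  move=> /CNzu Czu; rewrite -[f u]opprK -fN lerNl; apply: f_ge.
  by rewrite /A/= scaleN1r addrC.
have fcont : continuous f.
  apply: additive_continuous => // e e0.
  have e'0 : e != 0 by rewrite gt_eqF.
  have eU := nbhs0Z e'0 U0.
  apply: (filterS _ (filterI eU (nbhs0N eU))) => _ [[u Uu <-] [_ [v Uv <-] vu]].
  rewrite ler_norml; apply/andP; split.
    by rewrite -vu fN lerN2 fZ ler_piMr ?fU// ltW.
  by rewrite fZ ler_piMr ?fU// ltW.
have flin : linear f by move=> k x y; rewrite fD fZ.
have f_dual : f \in @clin_pred R E R^o by rewrite inE.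
exists (Clin f_dual); split=> [x Cx|/=].
  by apply: f_ge; rewrite /A/= scale0r addr0.
apply: (@le_lt_trans _ _ (-1)); last by rewrite ltrN10.
rewrite -[f z]opprK -fN lerN2; apply: f_ge.
by rewrite /A/= scale1r addNr.
Qed.

(** The cone form of the geometric Hahn-Banach theorem: for a cone, the
separating hyperplane can be taken through the origin. *)
Lemma cone_separation K (z : E) : convex_cone K -> ~ closure K z ->
  exists f : dual E, (forall x, K x -> 0 <= f x) /\ f z < 0.
Proof.
move=> cK /existsNP[S /not_implyP[zS KS]].
have [U [U0 cU US]] := nbhs_convex zS.
have KU0 : K `&` (+%R z @` U) = set0.
  apply/seteqP; split=> // w [Kw [u Uu zu]]; apply: KS.
  by exists w; split=> //; rewrite -zu; exact: US.
have [C CK maxC] := maximal_avoiding_cone cK KU0.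
have [cC KC CU] := CK.
have avC : avoiding_cone C (+%R z @` U) C by split.
have totC := maximal_avoiding_cone_total cU avC maxC.
have [|f [fC fz]] := half_space_functional U0 cC totC (z := z).
  move=> u Uu Czu; have : (C `&` (+%R z @` U)) (z + u) by split=> //; exists u.
  by rewrite CU.
by exists f; split=> // x /KC; exact: fC.
Qed.

End cone_separation.

(** * Conjugates, semicontinuity and closures *)

Lemma conj_fun_leP (R : realType) (Y : tvsType R) (f : Y -> \bar R)
    (ys : dual Y) (k : R) :
  (conj_fun f ys <= k%:E)%E <-> forall y, ((ys y - k)%:E <= f y)%E.
Proof.
have leE (a : R) (v : \bar R) : (a%:E - v <= k%:E)%E = ((a - k)%:E <= v)%E.
  case: v => [r| |]; rewrite ?leNye ?leey// -EFinB !lee_fin.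
  by rewrite lerBlDr lerBlDl addrC.
split=> [fk y|fk].
  by rewrite -leE (le_trans _ fk)//; apply: ereal_sup_ubound; exists y.
by apply: ge_ereal_sup => _ [y _ <-]; rewrite leE.
Qed.

Lemma lsc_at_not_closure_epi (R : realType) (Y : topologicalType)
    (f : Y -> \bar R) (b : Y) (r : R) :
  f b \is a fin_num -> lsc_at f b -> (r%:E < f b)%E -> ~ closure (epi f) (b, r).
Proof.
move=> fb flsc rb cl; pose r' := (r + fine (f b)) / 2.
have rfb : r < fine (f b) by rewrite -lte_fin fineK.
have rr' : r < r' by rewrite /r'; lra.
have : (r'%:E < f b)%E by rewrite -(fineK fb) lte_fin /r'; lra.
move=> /lt_le_trans/(_ flsc); rewrite limf_einfE => /ereal_sup_gt[_ [V bV <-]] r'V.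
have [|[y t] [/= fyt [Vy /= tr']]] := cl (V `*` [set t | t < r']).
  by exists (V, [set t | t < r']) => //; split => //=; exact: lt_nbhsl.
have : (ereal_inf (f @` V) <= f y)%E by apply: ereal_inf_lbound; exists y.
move=> /(lt_le_trans r'V)/lt_le_trans/(_ fyt).
by rewrite lte_fin ltNge ltW.
Qed.

Lemma closure_scale (R : realType) (E : tvsType R) (S : set E) (t : R) (p : E) :
  t != 0 -> (forall q, S q -> S (t *: q)) -> closure S p -> closure S (t *: p).
Proof.
move=> t0 SZ clp B tpB.
have tV0 : t^-1 != 0 by rewrite invr_eq0.
have := nbhsZ tV0 tpB; rewrite scalerA mulVf// scale1r => /clp[v [Sq [w Bw wv]]].
exists w; split=> //; move: (SZ _ Sq); rewrite -wv.
by rewrite scalerA divff// scale1r.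
Qed.

Section left_injection.
Context {R : realType} (X Y : tvsType R).

Let inl_clin_subproof : (fun x => (x, 0)) \in @clin_pred R X (X * Y)%type.
Proof.
rewrite inE; split=> [k x y|x]; first by congr (_, _); rewrite /= scaler0 addr0.
by apply: cvg_pair; [exact: cvg_id|exact: cvg_cst].
Qed.

Definition inl_clin : clin X (X * Y)%type := Clin inl_clin_subproof.

End left_injection.

(** * Duality for the conic linear program *)

Section conic_duality.
Context {R : realType} {X Y : tvsType R}.
Context (P : set X) (Q : set Y) (A : clin X Y).
Hypotheses (coneP : convex_cone P) (coneQ : convex_cone Q).
Context (c : dual X).
Local Notation h := (value_fun P Q A c).

Lemma dual_feasibleE (ys : dual Y) : dual_feasible P Q A c ys <->
  (forall q, Q q -> 0 <= ys q) /\ (forall x, P x -> ys (A x) <= c x).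
Proof.
split=> [[Qys [ps Pps psE]]|[Qys Pys]].
  split=> // x /Pps; rewrite -[ps]opprK psE opprB clinDE clinNE /=.
  by rewrite subr_ge0.
split=> //; exists (c - adjoint A ys); last by rewrite opprB.
by move=> x Px; rewrite clinDE clinNE /= subr_ge0; exact: Pys.
Qed.

Lemma value_fun_le x y : P x -> Q (A x - y) -> (h y <= (c x)%:E)%E.
Proof. by move=> Px Qxy; apply: ereal_inf_lbound; exists x. Qed.

Lemma value_fun_domE y :
  (h y < +oo)%E <-> exists2 x, P x & Q (A x - y).
Proof.
split=> [/ereal_inf_lt[_ [x [Px Qx] _] _]|[x Px Qx]]; first by exists x.
by rewrite (le_lt_trans (value_fun_le Px Qx))// ltry.
Qed.

Lemma value_fun0_le0 : (h 0%R <= 0)%E.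
Proof.
have := @value_fun_le 0 0; rewrite subr0 !linear0; apply; exact: convex_cone0.
Qed.

Lemma feasible_minorant (ys : dual Y) :
  dual_feasible P Q A c ys -> forall y, ((ys y)%:E <= h y)%E.
Proof.
move=> /dual_feasibleE[Qys Pys] y; apply: le_ereal_inf_tmp => _ [x [Px Qx] <-].
rewrite lee_fin (le_trans _ (Pys _ Px))// -subr_ge0 -raddfB.
exact: Qys.
Qed.

(** A point [x] of [P] with [A x - y] in [Q] and [c x < ys y] would stay so after
scaling, and the difference [ys y - c x] would eventually exceed [k]. *)
Lemma affine_minorant_feasible (ys : dual Y) (k : R) :
  (forall y, ((ys y - k)%:E <= h y)%E) -> dual_feasible P Q A c ys.
Proof.
move=> ysk; have [_ _ PZ] := coneP; have [_ _ QZ] := coneQ.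
have ysle x y : P x -> Q (A x - y) -> ys y <= c x.
  move=> Px Qxy; rewrite leNgt; apply/negP => cys.
  (* The scaling factor that makes the difference [`|k| + 1], more than [k]. *)
  pose t := (`|k| + 1) / (ys y - c x).
  have t0 : 0 <= t by apply: divr_ge0; [exact: addr_ge0|rewrite subr_ge0 ltW].
  have := le_trans (ysk (t *: y)) (@value_fun_le (t *: x) (t *: y) _ _).
  rewrite !linearZ/= -scalerDr => /(_ (PZ _ _ t0 Px) (QZ _ _ t0 Qxy)).
  rewrite lee_fin lerBlDr -lerBlDl -scalerBr /t.
  rewrite /GRing.scale/= mulfVK ?subr_eq0 ?gt_eqF//.
  by rewrite leNgt => /negP; apply; rewrite (le_lt_trans (ler_norm k))// ltrDl.
apply/dual_feasibleE; split=> [q Qq|x Px].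
  have := @ysle 0 (- q); rewrite opprK !linear0 add0r raddfN oppr_le0.
  by apply=> //; exact: convex_cone0.
by apply: ysle => //; rewrite subrr; exact: convex_cone0.
Qed.

Lemma conj_value_fun_ge0 ys : (0 <= conj_fun h ys)%E.
Proof.
apply: le_ereal_sup_tmp; exists ((ys 0%R)%:E - h 0%R)%E; first by exists 0.
by rewrite linear0 sub0e oppe_ge0 value_fun0_le0.
Qed.

Lemma conj_value_fun_feasible ys :
  dual_feasible P Q A c ys -> conj_fun h ys = 0%E.
Proof.
move=> /feasible_minorant ysh; apply/eqP; rewrite eq_le conj_value_fun_ge0 andbT.
by apply/conj_fun_leP => y; rewrite subr0; exact: ysh.
Qed.

Lemma conj_value_fun_dom ys :
  (conj_fun h ys < +oo)%E <-> dual_feasible P Q A c ys.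
Proof.
split=> [ys_oo|/conj_value_fun_feasible ->]; last by rewrite ltry.
have fin : conj_fun h ys \is a fin_num.
  by rewrite ge0_fin_numE// conj_value_fun_ge0.
apply: (@affine_minorant_feasible _ (fine (conj_fun h ys))).
by apply/conj_fun_leP; rewrite fineK.
Qed.

Lemma biconj_value_fun b : biconj_fun h b = dual_val P Q A c b.
Proof.
apply/eqP; rewrite eq_le; apply/andP; split.
  apply: ge_ereal_sup => _ [ys _ <-].
  have [ys_oo|] := ltP (conj_fun h ys) +oo%E; last first.
    by rewrite leye_eq => /eqP ->; rewrite leNye.
  have ysF := (conj_value_fun_dom ys).1 ys_oo.
  rewrite conj_value_fun_feasible// sube0.
  by apply: ereal_sup_ubound; exists ys.
apply: ge_ereal_sup => _ [ys ysF <-]; apply: ereal_sup_ubound; exists ys => //.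
by rewrite conj_value_fun_feasible// sube0.
Qed.

Lemma weak_duality b : (dual_val P Q A c b <= h b)%E.
Proof.
by apply: ge_ereal_sup => _ [ys /feasible_minorant ysh <-]; exact: ysh.
Qed.

(** The subgradient inequality at [b] bounds [h] below by an affine functional,
which makes [ys] dual feasible, hence [ys b <= h b]; its instance at [0] gives
the reverse inequality because [h 0 <= 0]. *)
Lemma subdiff_value_funP b (ys : dual Y) : subdiff h b ys <->
  dual_feasible P Q A c ys /\ (ys b)%:E = h b.
Proof.
split=> [[hb ysb]|[ysF ysb]].
  have ysF : dual_feasible P Q A c ys.
    apply: (@affine_minorant_feasible _ (ys b - fine (h b))) => y.
    by have := ysb y; rewrite raddfB leeBrDr// -{1}(fineK hb) -EFinD opprB addrA addrAC.
  split=> //; apply/eqP; rewrite eq_le feasible_minorant//=.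
  have := ysb 0; rewrite sub0r raddfN leeBrDr// => /le_trans/(_ value_fun0_le0).
  by rewrite -(fineK hb) -EFinD !lee_fin addrC subr_le0.
have hb : h b \is a fin_num by rewrite -ysb.
split=> // y; rewrite leeBrDr// -ysb -EFinD raddfB subrK.
exact: feasible_minorant.
Qed.

(** The epigraph of [h] without the points [(y, h y)] at which the infimum
[h y] is not attained. It has the same closure, and it is a convex cone without
any argument about infima. *)
Let K : set (Y * R^o) :=
  [set yt | exists2 x, P x & Q (A x - yt.1) /\ c x <= yt.2].

Let coneK : convex_cone K.
Proof.
have [_ PD PZ] := coneP; have [_ QD QZ] := coneQ; split.
- exists 0; exists 0; first exact: convex_cone0.
  by rewrite subr0 !linear0; split=> //; exact: convex_cone0.
- move=> [y t] [y' t'] [x Px [/= Qx xt]] [x' Px' [/= Qx' xt']].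
  exists (x + x'); first exact: PD.
  rewrite /= !raddfD/= addrACA; split; first exact: QD.
  exact: lerD.
- move=> r [y t] r0 [x Px [/= Qx xt]]; exists (r *: x); first exact: PZ.
  rewrite /= !linearZ/= -scalerDr; split; first exact: QZ.
  exact: ler_wpM2l.
Qed.

(** A functional [f] on [Y * R] separating [(b, r)] from [K] has a nonnegative
slope [s] in the second variable, since [K] contains [(0, 1)]. Were [s] zero, [f]
could not separate [(b, r)] from the points of [K] above [b], which exist as
[b] is in the domain of [h]. So the kernel of [f] is the graph of a linear
functional; it lies below [K], hence is dual feasible, and above [r] at [b]. *)
Lemma approximate_dual_solution b (r : R) :
  (h b < +oo)%E -> ~ closure (epi h) (b, r) ->
  exists2 ys, dual_feasible P Q A c ys & r < ys b.
Proof.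
move=> /value_fun_domE[x0 Px0 Qx0] hbr.
have [|f [fK fbr]] := @cone_separation R (Y * R^o)%type K (b, r) coneK.
  apply: contra_not hbr; apply: closureS => -[y t] [x Px [/= Qx xt]].
  by rewrite /epi/= (le_trans (value_fun_le Px Qx)).
pose s : R := f (0, 1).
have fE y (t : R) : f (y, t) = t * s + f (y, 0).
  rewrite -(clin_linear f t (0, 1) (y, 0)); congr (f (_, _)) => /=.
    by rewrite scaler0 add0r.
  by rewrite addr0 /GRing.scale/= mulr1.
have s0 : 0 <= s.
  apply: fK; exists 0; first exact: convex_cone0.
  by rewrite subr0 !linear0; split=> //; exact: convex_cone0.
have {}s0 : 0 < s.
  rewrite lt_neqAle s0 andbT; apply/eqP => s0'.
  have : 0 <= f (b, c x0) by apply: fK; exists x0.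
  by move: fbr; rewrite (fE b r) (fE b (c x0)) -s0' !mulr0 => /lt_geF ->.
exists (- s^-1 *: clin_comp f (inl_clin Y R^o)).
  apply/dual_feasibleE; split=> [q Qq|x Px]; rewrite clinZE /=.
    rewrite scaleNr -scalerN -raddfN /GRing.scale/= mulr_ge0 ?invr_ge0 ?(ltW s0)//.
    apply: fK; exists 0; first exact: convex_cone0.
    by rewrite /= !opprK !linear0 add0r.
  have : 0 <= f (A x, c x).
    apply: fK; exists x => //=; rewrite subrr; split=> //.
    exact: convex_cone0.
  rewrite fE /GRing.scale/= mulNr lerNl ler_pdivlMl//; lra.
move: fbr; rewrite fE clinZE /GRing.scale/= mulNr ltrNr ltr_pdivrMl//; lra.
Qed.

Lemma value_fun_le_dual b : h b \is a fin_num -> lsc_at h b ->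
  (h b <= dual_val P Q A c b)%E.
Proof.
move=> hb hlsc; apply/lee_subgt0Pr => e e0.
have hbe : ((fine (h b) - e)%:E < h b)%E.
  by rewrite -[ltRHS](fineK hb) lte_fin gtrBl.
have hb_oo : (h b < +oo)%E by rewrite -(fineK hb) ltry.
have [ys ysF bys] :=
  approximate_dual_solution hb_oo (lsc_at_not_closure_epi hb hlsc hbe).
apply: le_ereal_sup_tmp; exists (ys b)%:E; first by exists ys.
by rewrite -(fineK hb) -EFinB lee_fin ltW.
Qed.

(** The dual value is a supremum of continuous functions of [b]. *)
Lemma dual_val_le_limf_einf b :
  (dual_val P Q A c b <= limf_einf h (nbhs b))%E.
Proof.
rewrite limf_einfE; apply: ge_ereal_sup => _ [ys ysF <-].
apply/lee_subgt0Pr => e e0; apply: le_ereal_sup_tmp.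
exists (ereal_inf (h @` [set y | ys b - e < ys y])).
  exists [set y | ys b - e < ys y] => //.
  have br : ys b - e < ys b by rewrite gtrBl.
  exact: (@clin_continuous R Y R^o ys b _ (lt_nbhsr br)).
apply: le_ereal_inf_tmp => _ [y /= /ltW ysy <-].
by apply: le_trans (feasible_minorant ysF y); rewrite -EFinB lee_fin.
Qed.

Lemma lsc_env_value_fun0_le0 : (lsc_env h 0%R <= 0)%E.
Proof.
apply: ereal_inf_lbound; exists 0 => //; apply: subset_closure.
exact: value_fun0_le0.
Qed.

(** The epigraph of a continuous functional is closed, so it contains the closed
epigraph of [h] as soon as it contains that of [h]. *)
Lemma feasible_minorant_lsc_env (ys : dual Y) :
  dual_feasible P Q A c ys -> forall y, ((ys y)%:E <= lsc_env h y)%E.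
Proof.
move=> ysF y; apply: le_ereal_inf_tmp => _ [t yt <-]; rewrite lee_fin.
rewrite leNgt; apply/negP => tys; pose m := (t + ys y) / 2.
have tm : t < m by rewrite /m; lra.
have my : m < ys y by rewrite /m; lra.
have [|[y' t'] [/= hy't' [/= my' t'm]]] :=
    yt ([set y' | m < ys y'] `*` [set t' | t' < m]).
  exists ([set y' | m < ys y'], [set t' | t' < m]) => //; split => /=.
    exact: (@clin_continuous R Y R^o ys y _ (lt_nbhsr my)).
  exact: lt_nbhsl.
have := le_trans (feasible_minorant ysF y') hy't'; rewrite lee_fin leNgt.
by rewrite (lt_trans t'm my').
Qed.

Lemma epi_value_fun_scale (t : R) (p : Y * R^o) :
  0 < t -> epi h p -> epi h (t *: p).
Proof.
case: p => y s t0; rewrite /epi/= => hys; have [_ _ PZ] := coneP.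
have [_ _ QZ] := coneQ; apply/lee_addgt0Pr => e e0.
have : (h y < (s + e / t)%:E)%E.
  by rewrite (le_lt_trans hys)// lte_fin ltrDl divr_gt0.
move=> /ereal_inf_lt[_ [x [Px Qx] <-]]; rewrite lte_fin => /ltW xs.
apply: (@le_trans _ _ (c (t *: x))%:E).
  apply: value_fun_le; first by apply: PZ => //; exact: ltW.
  by rewrite linearZ/= -scalerBr; apply: QZ => //; exact: ltW.
rewrite linearZ -EFinD lee_fin /GRing.scale/=.
by rewrite -ler_pdivlMl// mulrDr mulKf ?gt_eqF// mulrC.
Qed.

(** If [(0, -1)] were in the closed epigraph, then so would be all its positive
multiples, and the envelope would be [-oo] at [0]. *)
Lemma proper_lsc_env_feasible : proper_fun (lsc_env h) ->
  dual_feasible P Q A c !=set0.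
Proof.
move=> [_ /(_ 0) henv0].
have h0 : (h 0%R < +oo)%E by rewrite (le_lt_trans value_fun0_le0)// ltry.
have [|ys ysF _] := @approximate_dual_solution 0 (-1) h0; last by exists ys.
apply: contraNnot henv0 => cl01; apply/eqP/eq_ninfty => M.
(* The multiple [(0, - (`|M| + 1))] lies below [M]. *)
have t0 : 0 < `|M| + 1 by rewrite ltr_wpDl.
have := @closure_scale R (Y * R^o)%type _ _ _ (lt0r_neq0 t0)
  (fun q => @epi_value_fun_scale _ q t0) cl01.
have -> : (`|M| + 1) *: ((0, -1) : Y * R^o) = (0, - (`|M| + 1)).
  by congr (_, _) => /=; rewrite ?scaler0// /GRing.scale/= mulrN1.
move=> cl; apply: (@le_trans _ _ (- (`|M| + 1))%:E).
  by apply: ereal_inf_lbound; exists (- (`|M| + 1)).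
by rewrite lee_fin lerNl (le_trans (ler_norm _))// normrN lerDl.
Qed.

Lemma conj_value_fun_proper :
  proper_fun (conj_fun h) <-> edom (conj_fun h) !=set0.
Proof.
split=> [[]//|domh]; split=> // ys.
by rewrite gt_eqF// (lt_le_trans _ (conj_value_fun_ge0 ys)).
Qed.

Lemma primal_domP b : (h b < +oo)%E <-> primal_dom P Q A b.
Proof.
rewrite value_fun_domE; split=> [[x Px Qx]|[_ [x Px <-] [q Qq <-]]].
  exists (A x); first by exists x.
  by exists (A x - b) => //; rewrite opprB addrC subrK.
by exists x; rewrite // opprB addrC subrK.
Qed.

Lemma dual_domP : dual_feasible P Q A c !=set0 <-> dual_dom P Q A c.
Proof.
split=> [[ys [Qys [ps Pps psE]]]|[ps Pps [_ [ys Qys <-] psE]]].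
  exists ps => //; exists (adjoint A ys); first by exists ys.
  by rewrite -[ps]opprK psE opprB subrK.
exists ys; split=> //; exists ps => //.
by rewrite -psE opprD addrCA subrr addr0.
Qed.

Lemma dual_val_gtNy b :
  (-oo < dual_val P Q A c b)%E <-> dual_feasible P Q A c !=set0.
Proof.
split=> [/ereal_sup_gt[_ [ys ysF _] _]|[ys ysF]]; first by exists ys.
by apply: (lt_le_trans (ltNyr (ys b))); apply: ereal_sup_ubound; exists ys.
Qed.

Lemma lsc_env_value_fun_proper :
  proper_fun (lsc_env h) <-> dual_feasible P Q A c !=set0.
Proof.
split=> [|[ys ysF]]; first exact: proper_lsc_env_feasible.
split=> [|y]; first by exists 0; exact: le_lt_trans lsc_env_value_fun0_le0 (ltry _).
by rewrite gt_eqF// (lt_le_trans (ltNyr (ys y)))// feasible_minorant_lsc_env.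
Qed.

Lemma edom_conj_value_fun :
  edom (conj_fun h) !=set0 <-> dual_feasible P Q A c !=set0.
Proof. by split=> -[ys /conj_value_fun_dom ysF]; exists ys. Qed.

Lemma lsc_at_value_funP b :
  h b \is a fin_num /\ lsc_at h b <->
  h b = dual_val P Q A c b /\ h b \is a fin_num.
Proof.
split=> [[hb hlsc]|[hd hb]]; split=> //; last first.
  by rewrite /lsc_at hd dual_val_le_limf_einf.
by apply/eqP; rewrite eq_le weak_duality value_fun_le_dual.
Qed.

Lemma dual_sol_subdiff b :
  subdiff h b !=set0 -> dual_sol P Q A c b = subdiff h b.
Proof.
move=> [xs /subdiff_value_funP[xsF xsb]].
have hd : h b = dual_val P Q A c b.
  apply/eqP; rewrite eq_le weak_duality andbT -xsb.
  by apply: ereal_sup_ubound; exists xs.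
by apply/seteqP; split=> ys; rewrite subdiff_value_funP /dual_sol/= hd.
Qed.

Lemma subdiff_value_fun_neq0 b : subdiff h b !=set0 <->
  [/\ h b = dual_val P Q A c b, h b \is a fin_num & dual_sol P Q A c b !=set0].
Proof.
split=> [hb0|[hd hb [ys [ysF ysb]]]]; last first.
  by exists ys; apply/subdiff_value_funP; rewrite hd.
have [ys /[dup] ysh /subdiff_value_funP[_ ysb]] := hb0.
move: ysh; rewrite -(dual_sol_subdiff hb0) => -[ysF ysd].
by split; [rewrite -ysb|rewrite -ysb|exists ys].
Qed.

End conic_duality.

(** * Values, duality gap, subgradients and properness *)

Local Open Scope ereal_scope.

Theorem proposition1 (R : realType) (X Y : tvsType R)
    (hausX : hausdorff_space X) (hausY : hausdorff_space Y)
    (A : clin X Y) (P : set X) (Q : set Y)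
    (coneP : convex_cone P) (coneQ : convex_cone Q) :
  (* (i) *)
  (forall (c : dual X) (b : Y),
    [/\ value_fun P Q A c b = primal_val P Q A c b,
        biconj_fun (value_fun P Q A c) b = dual_val P Q A c b,
        primal_val P Q A c b >= dual_val P Q A c b,
        primal_val P Q A c b < +oo <-> primal_dom P Q A b
      & dual_val P Q A c b > -oo <-> dual_dom P Q A c]) /\
  (forall (c : dual X) (b : Y), Lambda P Q A (c, b) ->
    0 <= gap P Q A c b < +oo) /\
  (* (ii) *)
  (forall (c : dual X) (b : Y),
    (value_fun P Q A c b \is a fin_num /\ lsc_at (value_fun P Q A c) b) <->
    (primal_val P Q A c b = dual_val P Q A c b /\
     primal_val P Q A c b \is a fin_num)) /\
  (* (iii) *)
  (forall (c : dual X) (b : Y),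
    (subdiff (value_fun P Q A c) b !=set0 <->
     [/\ primal_val P Q A c b = dual_val P Q A c b,
         primal_val P Q A c b \is a fin_num
       & dual_sol P Q A c b !=set0]) /\
    (subdiff (value_fun P Q A c) b !=set0 ->
     dual_sol P Q A c b = subdiff (value_fun P Q A c) b)) /\
  (* (iv) *)
  (forall c : dual X,
    [/\ proper_fun (lsc_env (value_fun P Q A c)) <->
          proper_fun (conj_fun (value_fun P Q A c)),
        proper_fun (conj_fun (value_fun P Q A c)) <->
          edom (conj_fun (value_fun P Q A c)) !=set0
      & edom (conj_fun (value_fun P Q A c)) !=set0 <-> dual_dom P Q A c]).
Proof.
have weak c b : dual_val P Q A c b <= primal_val P Q A c b.
  exact: weak_duality.
split.
  move=> c b; split=> //.
  - exact: biconj_value_fun.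
  - exact: primal_domP.
  - by rewrite dual_val_gtNy dual_domP.
split.
  move=> c b [/= [x xF] /(dual_val_gtNy P Q A c b) d_gt].
  have p_lt : primal_val P Q A c b < +oo.
    by apply/(value_fun_domE P Q A c b); case: xF => Px Qx; exists x.
  have p_fin : primal_val P Q A c b \is a fin_num.
    by rewrite fin_real// p_lt (lt_le_trans d_gt).
  have d_fin : dual_val P Q A c b \is a fin_num.
    by rewrite fin_real// d_gt (le_lt_trans (weak c b)).
  by rewrite /gap sube_ge0 ?d_fin// weak -(fineK p_fin) -(fineK d_fin) ltry.
split; first by move=> c b; exact: lsc_at_value_funP.
split.
  by move=> c b; split; [exact: subdiff_value_fun_neq0|exact: dual_sol_subdiff].
move=> c; split.
- by rewrite lsc_env_value_fun_proper// conj_value_fun_proper// edom_conj_value_fun.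
- exact: conj_value_fun_proper.
- by rewrite edom_conj_value_fun// dual_domP.
Qed.
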